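(* Let $K$ be a field of characteristic $0$. Then the following conditions are equivalent: 1. the transcendence degree of $K$ over $\mathbb{Q}$ is greater than $1$; 2. there exist two derivations $d_1, d_2 : K \to K$ whose kernels are incomparable with respect to inclusion; 3. there exist a field $L$ containing $K$ and two derivations $d_1, d_2 : K \to L$ whose kernels are incomparable with respect to inclusion.
   Context: For a field $L$ containing a field $K$, a derivation $d : K \to L$ is a map satisfying $d(x+y) = d(x)+d(y)$ and $d(xy) = x\,d(y) + d(x)\,y$ for all $x,y \in K$. Its kernel is $K^d = \{r \in K \mid d(r) = 0\}$. Two derivations $d_1,d_2$ have incomparable kernels if neither kernel is contained in the other, i.e. there exist $x_1, x_2 \in K$ with $d_1(x_1)\neq 0$, $d_1(x_2) = 0$, $d_2(x_1) = 0$, $d_2(x_2) \neq 0$. *)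

(* Defs.v *)
From mathcomp Require Import all_boot all_order all_algebra.
From mathcomp Require Import boolp classical_sets functions cardinality.
From mathcomp Require Import mpoly.

Set Implicit Arguments.
Unset Strict Implicit.
Unset Printing Implicit Defensive.

Import GRing.Theory.

Local Open Scope classical_set_scope.
Local Open Scope card_scope.
Local Open Scope ring_scope.

Section TranscendenceDegree.

Variable K : fieldType.
Implicit Types B C : set K.

(* [ratr] is the embedding of Q into K only when K has characteristic 0; the
   notions of this section are meant for such fields. *)
Definition alg_independent B : Prop :=
  forall (n : nat) (x : 'I_n -> K), injective x -> (forall i, B (x i)) ->
  forall p : {mpoly rat[n]}, mmap (@ratr K) x p = 0 -> p = 0.

Definition transcendence_basis B : Prop :=
  alg_independent B /\ forall C, alg_independent C -> B `<=` C -> C = B.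

(* The transcendence degree is the common cardinality of all transcendence
   bases, so it exceeds n when some basis has more than n elements; it may be
   an infinite cardinal. *)
Definition trdeg_gt (n : nat) : Prop :=
  exists B, transcendence_basis B /\ ~~ (B #<= `I_n).

End TranscendenceDegree.

Section Derivations.

Variables K L : fieldType.

(* A field L containing K is given by a ring morphism K -> L, which is
   necessarily injective. *)
Definition is_derivation (iota : {rmorphism K -> L}) (d : K -> L) : Prop :=
  (forall x y, d (x + y) = d x + d y) /\
  (forall x y, d (x * y) = iota x * d y + d x * iota y).

Definition der_kernel (d : K -> L) : set K := [set r | d r = 0].

Definition incomparable_kernels (d1 d2 : K -> L) : Prop :=
  ~ (der_kernel d1 `<=` der_kernel d2) /\ ~ (der_kernel d2 `<=` der_kernel d1).

End Derivations.

(* Main.v *)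
Require Import Defs.
From mathcomp Require Import all_boot all_order all_algebra.
From HB Require Import structures.
From mathcomp Require Import boolp classical_sets functions cardinality.
From mathcomp Require Import mpoly ring zify.

(** If d1 a = 0 <> d2 a and d2 b = 0 <> d1 b, then a and b are algebraically
    independent over Q: applying d1 and d2 to a relation p(a, b) = 0 shows that
    both partial derivatives of p vanish at (a, b), and one descends on the
    degree of p. Conversely, if x and y are algebraically independent, the
    partial derivatives on Q[x, y] are derivations dual to (x, y), and each of
    them extends to K: by Zorn's lemma there is a maximal extension, and one
    defined on a subring R extends further to R[z] for every z in K, because an
    element algebraic over a field of characteristic 0 is separable. *)

Set Implicit Arguments.
Unset Strict Implicit.
Unset Printing Implicit Defensive.

Import GRing.Theory Num.Theory.
Local Open Scope classical_set_scope.
Local Open Scope card_scope.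
Local Open Scope ring_scope.

(** * First-order Taylor expansion and dual numbers *)

Lemma horner_addsqr0 (R : comNzRingType) (p : {poly R}) (x e : R) :
  e * e = 0 -> p.[x + e] = p.[x] + p^`().[x] * e.
Proof.
move=> e2; elim/poly_ind: p => [|p c IHp]; first by rewrite deriv0 !hornerC mul0r addr0.
rewrite derivD derivM derivX derivC !hornerE IHp.
by ring: e2.
Qed.

(** The pair [(a, b)] stands for [a + b e] with [e * e = 0]. The type has its own name so that its
    product can differ from the componentwise one on [R * R]. *)
Definition dual (R : Type) : Type := (R * R)%type.

HB.instance Definition _ (R : zmodType) :=
  GRing.Zmodule.copy (dual R) (R * R)%type.

Section DualNumbers.

Variable R : comNzRingType.
Implicit Types u v w : dual R.

Definition dual_one : dual R := (1, 0).
Definition dual_mul u v : dual R := (u.1 * v.1, u.1 * v.2 + u.2 * v.1).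

Fact dual_mulA : associative dual_mul.
Proof.
by move=> u v w; congr pair => /=; ring.
Qed.

Fact dual_mulC : commutative dual_mul.
Proof.
by move=> u v; congr pair => /=; ring.
Qed.

Fact dual_mul1 : left_id dual_one dual_mul.
Proof. by case=> a b; congr pair => /=; rewrite mul1r ?mul0r ?addr0. Qed.

Fact dual_mulDl : left_distributive dual_mul +%R.
Proof.
by move=> u v w; congr pair => /=; ring.
Qed.

Fact dual_one_neq0 : dual_one != 0.
Proof. by rewrite xpair_eqE oner_eq0. Qed.

HB.instance Definition _ := GRing.Zmodule_isComNzRing.Build (dual R)
  dual_mulA dual_mulC dual_mul1 dual_mulDl dual_one_neq0.

End DualNumbers.


(** * Extension of a derivation from a subring of [K] to [K] *)

Section DerivationExtension.

Variable K : fieldType.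
Implicit Types (A : set (dual K)) (u v : dual K).

(* The graph of a derivation from a subring of K to K is a subring of the dual
   numbers over K that meets the ideal (0, K) trivially. *)
Definition derivation_graph A : Prop :=
  [/\ A 1, forall u v, A u -> A v -> A (u - v),
      forall u v, A u -> A v -> A (u * v)
    & forall u, A u -> u.1 = 0 -> u = 0].

Hypothesis charK : [pchar K] =i pred0.

Section Adjoin.

Variables (A : set (dual K)) (graphA : derivation_graph A) (z : K).

Let S : {pred dual K} := fun u => `[< A u >].

Let S_subring : subring_closed S.
Proof.
case: graphA => A1 AB AM _; split; first exact/asboolP.
  by move=> u v /asboolP Au /asboolP Av; apply/asboolP/AB.
by move=> u v /asboolP Au /asboolP Av; apply/asboolP/AM.
Qed.

HB.instance Definition _ := GRing.isSubringClosed.Build (dual K) S S_subring.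

Let S_eq0 u : u \in S -> u.1 = 0 -> u = 0.
Proof. by case: graphA => _ _ _ A0 /asboolP /A0. Qed.

(** As [(0, w)] squares to zero, the choice of [w] affects only the second component, and affinely,
    with slope the first component of [p'] at [(z, 0)]. *)
Let horner_shift (p : {poly dual K}) (w : K) :
  p.[((z, w) : dual K)] =
  p.[((z, 0) : dual K)] + p^`().[((z, 0) : dual K)] * ((0, w) : dual K).
Proof.
rewrite -horner_addsqr0; first by congr horner; congr pair; rewrite /= ?addr0 ?add0r.
by congr pair; rewrite /= ?mul0r ?mulr0 ?addr0.
Qed.

Let horner_shift_fst (p : {poly dual K}) (w : K) :
  (p.[((z, w) : dual K)]).1 = (p.[((z, 0) : dual K)]).1.
Proof. by rewrite horner_shift /= mulr0 addr0. Qed.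

(** Characteristic 0 only makes the first components of the higher coefficients vanish; the graph
    condition then kills the second ones. *)
Let deriv_eq0 (p : {poly dual K}) :
  p \is a polyOver S -> p^`() = 0 -> p = (p`_0)%:P.
Proof.
move=> /polyOverP pS p'0; apply/polyP=> -[|i]; rewrite coefC //=.
apply: S_eq0 => //; move/(congr1 (fun q : {poly dual K} => q`_i)): p'0.
rewrite coef_deriv coef0 => /(congr1 fst) /=.
have -> k : (p`_i.+1 *+ k).1 = (p`_i.+1).1 *+ k.
  by elim: k => // k IHk; rewrite !mulrS /= IHk.
move=> /eqP; rewrite -mulr_natr mulf_eq0 ((pcharf0P K).1 charK) orbF.
by move/eqP.
Qed.

(* If z is algebraic over the domain of the derivation then w is forced to be
   - m^d(z) / m'(z) for a minimal annihilating polynomial m; otherwise any w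
   is suitable. *)
Lemma derivation_graph_value :
  exists w : K, forall p : {poly dual K}, p \is a polyOver S ->
    (p.[((z, 0) : dual K)]).1 = 0 -> p.[((z, w) : dual K)] = 0.
Proof.
pose annih p := [/\ p \is a polyOver S, p != 0 & (p.[((z, 0) : dual K)]).1 = 0].
case: (pselect (exists p, annih p)) => [[p0 ann0]|no_annih]; last first.
  exists 0 => p pS pz; have [->|p_neq0] := eqVneq p 0; first exact: horner0.
  by case: no_annih; exists p.
have ex_size : exists n, `[< exists2 p, annih p & size p = n >].
  by exists (size p0); apply/asboolP; exists p0.
case: (ex_minnP ex_size) => _ /asboolP[m [mS m_neq0 mz] <-] m_min {p0 ann0 ex_size}.
have m_leq p : annih p -> (size m <= size p)%N.
  by move=> ann_p; apply: m_min; apply/asboolP; exists p.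
(* Separability: if the derivative of [m] vanished at [z], it would be a shorter annihilator. It is
   nonzero, since otherwise [m] would be a constant with first component 0, hence 0. *)
have m'z : (m^`().[((z, 0) : dual K)]).1 != 0.
  apply/eqP => m'z.
  have m'_neq0 : m^`() != 0.
    apply/eqP => /(deriv_eq0 mS) mC; move: mz; rewrite mC hornerC => m0.
    by move: m_neq0; rewrite mC polyC_eq0 (S_eq0 _ m0) ?eqxx ?(polyOverP mS).
  have /m_leq : annih m^`() by split=> //; apply: polyOver_deriv.
  by rewrite leqNgt lt_size_deriv.
set a := (m^`().[((z, 0) : dual K)]).1 in m'z.
exists (- (m.[((z, 0) : dual K)]).2 / a).
set w := _ / a.
have mw : m.[((z, w) : dual K)] = 0.
  rewrite horner_shift; apply: injective_projections; rewrite /= ?mulr0 ?mz ?addr0 //.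
  by rewrite -/a /w mulrCA divff // mulr1 subrr.
move=> p; elim: (size p) {-2}p (leqnn (size p)) => {p}[|n IHn] p.
  by rewrite leqn0 size_poly_eq0 => /eqP -> _ _; rewrite horner0.
move=> + pS pz; rewrite leq_eqVlt => /orP[/eqP size_p|]; last by move/IHn; apply.
have p_neq0 : p != 0 by rewrite -size_poly_eq0 size_p.
have size_mp : (size m <= size p)%N by apply: m_leq.
have lead_neq0 : (lead_coef m).1 != 0.
  apply: contra m_neq0 => /eqP lead0; rewrite -lead_coef_eq0.
  by apply/eqP/S_eq0; rewrite ?lead0 // (polyOverP mS).
(* One step of pseudo-division by [m]: the coefficients lie in a mere subring, so [p] is first
   multiplied by [lead_coef m] to make the leading terms cancel. *)
pose q := lead_coef m *: p - lead_coef p *: (m * 'X^(size p - size m)).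
have qS : q \is a polyOver S.
  by rewrite rpredB ?polyOverZ ?rpredM ?rpredX ?polyOverX ?(polyOverP mS) ?(polyOverP pS).
have qz : (q.[((z, 0) : dual K)]).1 = 0.
  by rewrite hornerD hornerN !hornerZ hornerM /= pz mz mul0r !mulr0 subr0.
have size_q : (size q <= n)%N.
  apply/leq_sizeP => j le_n_j; rewrite coefB !coefZ coefMXn.
  have le_k_n : (size p - size m <= n)%N.
    by move: m_neq0 size_p; rewrite -size_poly_gt0; lia.
  rewrite ltnNge (leq_trans le_k_n le_n_j) /=.
  move: le_n_j; rewrite leq_eqVlt => /orP[/eqP <-|lt_n_j].
    have -> : (n - (size p - size m) = (size m).-1)%N by lia.
    by rewrite {2}/lead_coef -[in n](_ : (size p).-1 = n) ?size_p // mulrC subrr.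
  have size_mj : (size m <= j - (size p - size m))%N.
    by rewrite size_p; move: size_mp; rewrite size_p; lia.
  have -> : p`_j = 0 by apply: nth_default; rewrite size_p.
  by rewrite (nth_default 0 size_mj) !mulr0 subrr.
have := IHn q size_q qS qz; rewrite hornerD hornerN !hornerZ hornerM mw mul0r mulr0 subr0.
have pw : (p.[((z, w) : dual K)]).1 = 0 by rewrite horner_shift_fst.
(* Since [p.[(z, w)]] has first component 0, its second component is multiplied by the nonzero
   scalar [(lead_coef m).1] only, which can be cancelled. *)
move=> /(congr1 snd) /= /eqP; rewrite pw mulr0 addr0 mulf_eq0 (negPf lead_neq0) /=.
by move=> /eqP pw2; apply: injective_projections.
Qed.

(** The new graph is the subring generated by [A] and [(z, w)]; the property of [w] is precisely
    what keeps it single-valued. *)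
Lemma derivation_graph_adjoin :
  exists (A' : set (dual K)) w,
    [/\ derivation_graph A', A `<=` A' & A' (z, w)].
Proof.
have [w wP] := derivation_graph_value.
exists [set p.[((z, w) : dual K)] | p in [set` polyOver S]], w.
split; first split.
- by exists 1; rewrite ?hornerE //= rpred1.
- move=> _ _ [p pS <-] [q qS <-]; exists (p - q); rewrite ?hornerE //=.
  exact: rpredB.
- move=> _ _ [p pS <-] [q qS <-]; exists (p * q); rewrite ?hornerM //=.
  exact: rpredM.
- by move=> _ [p pS <-]; rewrite horner_shift_fst => /(wP p pS).
- move=> u Au; exists u%:P; rewrite ?hornerC //=.
  by rewrite polyOverC; apply/asboolP.
- by exists 'X; rewrite ?hornerX //= polyOverX.
Qed.

End Adjoin.

Lemma derivation_graph_extend A :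
  derivation_graph A -> exists d : K -> K,
    is_derivation (idfun : {rmorphism K -> K}) d /\ forall u, A u -> d u.1 = u.2.
Proof.
move=> graphA.
pose P B := B = set0 \/ derivation_graph B /\ A `<=` B.
have [F FP totF|M [PM maxM]] := @Zorn_bigcup (dual K) P.
  have [[X FX [u Xu]]|F0] := pselect (exists2 X, F X & X !=set0); last first.
    left; rewrite bigcup0 // => X FX; apply: contrapT => /eqP/set0P[u Xu].
    by apply: F0; exists X => //; exists u.
  have FE Y v : F Y -> Y v -> derivation_graph Y /\ A `<=` Y.
    by move=> FY Yv; case: (FP Y FY) => // Y0; rewrite Y0 in Yv.
  have join Y Z v w : F Y -> Y v -> F Z -> Z w ->
      exists2 T, F T & [/\ T v, T w & derivation_graph T].
    move=> FY Yv FZ Zw; have [YZ|ZY] := totF Y Z FY FZ.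
      by exists Z => //; split; [exact: YZ| |case: (FE Z w)].
    by exists Y => //; split; [|exact: ZY|case: (FE Y v)].
  have [[X1 _ _ _] AX] := FE X u FX Xu.
  right; split; first split.
  - by exists X.
  - move=> v w [Y FY Yv] [Z FZ Zw].
    have [T FT [Tv Tw [_ TB _ _]]] := join _ _ _ _ FY Yv FZ Zw.
    by exists T => //; apply: TB.
  - move=> v w [Y FY Yv] [Z FZ Zw].
    have [T FT [Tv Tw [_ _ TM _]]] := join _ _ _ _ FY Yv FZ Zw.
    by exists T => //; apply: TM.
  - by move=> v [Y FY Yv]; have [[_ _ _ Y0] _] := FE Y v FY Yv; apply: Y0.
  - by move=> v /AX Xv; exists X.
have [graphM AM] : derivation_graph M /\ A `<=` M.
  case: PM => // M0; case: (maxM A); last by right; split.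
  by rewrite M0; split=> // A0; case: graphA => /A0.
(* Adjoining [z] to [M] cannot enlarge it, so [M] is already defined at [z]. *)
have totalM z : exists w, M (z, w).
  have [M' [w [graphM' MM' M'zw]]] := derivation_graph_adjoin graphM z.
  exists w; apply: contrapT => nMzw; apply: (maxM M').
    by split=> // /(_ _ M'zw).
  by right; split=> // u /AM /MM'.
have [d dP] := choice totalM; exists d.
have [_ MB MM M0] := graphM.
have uniqM z w : M (z, w) -> d z = w.
  move=> Mzw; have /M0 : M ((z, d z) - (z, w) : dual K) by apply: MB.
  by move=> /(_ (subrr z)) [_ /eqP]; rewrite subr_eq0 => /eqP.
have MD u v : M u -> M v -> M (u + v).
  move=> Mu Mv; rewrite -[v]opprK; apply: (MB u) => //.
  by rewrite -sub0r; apply: (MB 0) => //; rewrite -(subrr u); apply: MB.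
split; last by move=> [a b] /AM /uniqM.
split=> x y; apply: uniqM; first exact: (MD (x, d x) (y, d y)).
exact: (MM (x, d x) (y, d y)).
Qed.

End DerivationExtension.

(** * The embedding of the rationals and partial derivatives *)

Section RationalPolynomials.

Lemma ratr_rmorphism_char0 (K : fieldType) :
  [pchar K] =i pred0 -> exists f : {rmorphism rat -> K}, f =1 ratr.
Proof.
move=> charK.
have intr_neq0 (a : int) : a != 0 -> a%:~R != 0 :> K.
  case: a => k; rewrite ?NegzE ?rmorphN ?oppr_eq0 /=.
    by rewrite -pmulrn ((pcharf0P K).1 charK).
  by rewrite -pmulrn ((pcharf0P K).1 charK).
(* [ratr] is computed from the reduced fraction; in characteristic 0 every representation gives the
   same value, so additivity and multiplicativity become fraction arithmetic. *)
have ratrE (a b : int) : b != 0 -> ratr (a%:~R / b%:~R) = a%:~R / b%:~R :> K.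
  move=> b0; apply/eqP; rewrite /ratr eqr_div ?intr_neq0 ?denq_neq0 // -!rmorphM /=.
  set q := a%:~R / b%:~R; suff -> : numq q * b = a * denq q by [].
  apply: (@intr_inj rat); rewrite !rmorphM /= numqE /q mulrAC divfK // intr_eq0 //.
have ratB : zmod_morphism (@ratr K).
  move=> x y; rewrite -[x in x - y]divq_num_den -[y in _ - y]divq_num_den.
  rewrite -mulNr addf_div ?intq_eq0 ?denq_neq0 // -!rmorphN -!rmorphM -!rmorphD /=.
  rewrite ratrE ?mulf_neq0 ?denq_neq0 // !(rmorphD, rmorphM, rmorphN) /=.
  by rewrite -addf_div ?intr_neq0 ?denq_neq0 // mulNr.
have ratM : monoid_morphism (@ratr K).
  split=> [|x y]; first by rewrite /ratr divr1.
  rewrite -[x in x * y]divq_num_den -[y in _ * y]divq_num_den mulf_div -!rmorphM /=.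
  by rewrite ratrE ?mulf_neq0 ?denq_neq0 // !rmorphM -mulf_div.
pose aM := GRing.isZmodMorphism.Build rat K (@ratr K) ratB.
pose mM := GRing.isMonoidMorphism.Build rat K (@ratr K) ratM.
pose f : {rmorphism rat -> K} := HB.pack (@ratr K) aM mM.
by exists f.
Qed.

Variable n : nat.
Implicit Type p : {mpoly rat[n]}.

Lemma mderivXU (i j : 'I_n) : ('X_j : {mpoly rat[n]})^`M(i) = (j == i)%:R.
Proof.
rewrite mderivX mnm1E; case: eqVneq => [->|_]; last exact: scale0r.
have -> : (U_(i) - U_(i) = 0)%MM by apply/mnmP => k; rewrite mnmBE subnn mnm0E.
by rewrite scale1r mpolyX0.
Qed.

Lemma msize_mderiv_leq p (i : 'I_n) k :
  (msize p <= k.+1)%N -> (msize p^`M(i) <= k)%N.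
Proof.
move=> size_p; rewrite msizeE; apply/bigmax_leqP_seq => m + _.
rewrite mcoeff_msupp mcoeff_deriv => coef_neq0.
have : (m + U_(i))%MM \in msupp p.
  by rewrite mcoeff_msupp; apply: contraNneq coef_neq0 => ->; rewrite mul0rn.
by move/msize_mdeg_lt; rewrite mdegD mdeg1 addn1 => /leq_trans/(_ size_p).
Qed.

Lemma mderiv_eq0_mpolyC p : (forall i, p^`M(i) = 0) -> p = (p@_0)%:MP.
Proof.
move=> p'0; apply/mpolyP => m; rewrite mcoeffC.
have [->|/eqP m_neq0] := eqVneq 0%MM m; first by rewrite mulr1.
have [i mi] : exists i, m i != 0%N.
  apply: contrapT => m0; apply: m_neq0; apply/mnmP => i; rewrite mnm0E.
  by apply/esym/eqP; apply: contrapT => /negP mi; apply: m0; exists i.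
have /(congr1 (mcoeff (m - U_(i)))) := p'0 i.
rewrite mcoeff_deriv mcoeff0 submK ?lep1mP // mulr0.
by move/eqP; rewrite mulrn_eq0 => /eqP.
Qed.

End RationalPolynomials.

(** * Derivations and algebraic independence *)

Section DerivationsAndIndependence.

Variables (K L : fieldType) (iota : {rmorphism K -> L}).
Variable f : {rmorphism rat -> K}.

Section ChainRule.

Variables (d : K -> L) (d_der : is_derivation iota d).

Lemma derivation0 : d 0 = 0.
Proof.
case: d_der => dD _; have /eqP := dD 0 0.
by rewrite addr0 -[X in X == _]addr0 (inj_eq (addrI _)) eq_sym => /eqP.
Qed.

Lemma derivation_rat q : d (f q) = 0.
Proof.
have [dD dM] := d_der.
have d1 : d 1 = 0.
  have /eqP := dM 1 1; rewrite !rmorph1 !mul1r mulr1 -[X in X == _]addr0.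
  by rewrite (inj_eq (addrI _)) eq_sym => /eqP.
have dnat k : d k%:R = 0.
  by elim: k => [|k IHk]; rewrite ?derivation0 // mulrS dD d1 IHk addr0.
have dN x : d (- x) = - d x.
  by apply/eqP; rewrite -addr_eq0 -dD addNr derivation0.
have dint (a : int) : d a%:~R = 0.
  by case: a => k; rewrite ?NegzE ?rmorphN /= ?dN -?pmulrn ?dnat ?oppr0.
(* Apply [d] to [numq q = q * denq q]: integers are killed, which leaves [d (f q)] times a nonzero
   denominator equal to 0. *)
have /(congr1 (d \o f)) /= := numqE q; rewrite rmorphM !rmorph_int dint dM dint.
rewrite mulr0 add0r => /esym/eqP; rewrite mulf_eq0 => /orP[/eqP //|].
rewrite rmorph_int -(rmorph_int (iota \o f)) fmorph_eq0 intr_eq0.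
by rewrite (negPf (denq_neq0 q)).
Qed.

(** The chain rule with a single surviving term: it holds for constants and variables and is stable
    under products and sums. *)
Lemma derivation_mmap n (v : 'I_n -> K) (i : 'I_n) (p : {mpoly rat[n]}) :
  (forall j, j != i -> d (v j) = 0) ->
  d (mmap f v p) = iota (mmap f v p^`M(i)) * d (v i).
Proof.
move=> dv0; have [dD dM] := d_der.
pose E q := d (mmap f v q) = iota (mmap f v q^`M(i)) * d (v i).
have EC c : E c%:MP.
  by rewrite /E mmapC derivation_rat mderivC mmap0 rmorph0 mul0r.
have EM q r : E q -> E r -> E (q * r).
  rewrite /E => Eq Er.
  rewrite mderivM rmorphM dM Eq Er mmapD rmorphD !rmorphM /= mulrDl.
  by rewrite addrC mulrA; congr (_ + _); ring.
have EX j : E 'X_j.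
  rewrite /E mderivXU mmapX mmap1U !rmorph_nat.
  by case: eqVneq => [->|ji]; rewrite ?mul1r // dv0 // mul0r.
suff : E p by [].
elim/mpolyind: p => [|c m p _ _ Ep]; first by rewrite -(mpolyC0 n rat).
have Em : E 'X_[m].
  rewrite mpolyXE_id; apply: (big_ind E) => // [|j _]; first exact: EC.
  by elim: (m j) => [|k IHk]; rewrite ?exprS; [exact: EC|exact: EM].
have := EM _ _ (EC c) Em; rewrite mul_mpolyC /E => Ecm.
by rewrite mderivD !mmapD rmorphD mulrDl dD Ecm Ep.
Qed.

End ChainRule.

(* If p(v) = 0 then applying the d_i shows that all partial derivatives of p
   vanish at v too, so by induction on the degree they are all zero. *)
Lemma dual_derivations_independent n (v : 'I_n -> K) :
  (forall i, exists d : K -> L,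
     [/\ is_derivation iota d, d (v i) != 0 & forall j, j != i -> d (v j) = 0]) ->
  forall p : {mpoly rat[n]}, mmap f v p = 0 -> p = 0.
Proof.
move=> dual_v p; elim: (msize p) {-2}p (leqnn (msize p)) => {p}[|k IHk] p size_p pv0.
  by apply/eqP; rewrite -msize_poly_eq0 -leqn0.
have p'0 i : p^`M(i) = 0.
  apply: IHk (msize_mderiv_leq i size_p) _; have [d [d_der dvi dv0]] := dual_v i.
  have /eqP := derivation_mmap d_der p dv0.
  rewrite pv0 (derivation0 d_der) eq_sym mulf_eq0 (negPf dvi) orbF fmorph_eq0.
  by move/eqP.
move: pv0; rewrite (mderiv_eq0_mpolyC p'0) mmapC => /eqP.
by rewrite fmorph_eq0 => /eqP ->.
Qed.

End DerivationsAndIndependence.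

(** Independence makes evaluation at [v] injective, so the partial derivative along [i] descends to
    the values of polynomials at [v]; [range jet] is its graph, which is then extended to [K]. *)
Lemma exists_dual_derivation (K : fieldType) (f : {rmorphism rat -> K}) n
    (v : 'I_n -> K) (i : 'I_n) :
  [pchar K] =i pred0 ->
  (forall p : {mpoly rat[n]}, mmap f v p = 0 -> p = 0) ->
  exists2 d : K -> K, is_derivation (idfun : {rmorphism K -> K}) d &
    forall j, d (v j) = (j == i)%:R.
Proof.
move=> charK indep_v.
pose jet p : dual K := (mmap f v p, mmap f v p^`M(i)).
have graph_jet : derivation_graph (range jet).
  split.
  - exists 1 => //; apply: injective_projections; first exact: rmorph1.
    by rewrite /= -mpolyC1 mderivC mmap0.
  - move=> _ _ [p _ <-] [q _ <-]; exists (p - q) => //.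
    by rewrite /jet mderivB !mmapB.
  - move=> _ _ [p _ <-] [q _ <-]; exists (p * q) => //.
    rewrite /jet mderivM mmapD !rmorphM; apply: injective_projections => //=.
    by rewrite addrC.
  - by move=> _ [p _ <-] /= /indep_v ->; rewrite /jet mderiv0 !mmap0.
have [d [d_der dP]] := derivation_graph_extend charK graph_jet.
exists d => // j; have := dP _ (imageT jet 'X_j).
by rewrite /= mderivXU mmapX mmap1U rmorph_nat.
Qed.

(** * Chains of sets and existence of transcendence bases *)

Lemma chain_bigcup_finite (T : Type) (F : set (set T)) n (x : 'I_n -> T) :
  F !=set0 -> total_on F subset ->
  (forall i, (\bigcup_(X in F) X) (x i)) ->
  exists2 X, F X & forall i, X (x i).
Proof.
move=> [X0 FX0] totF; elim: n x => [|n IHn] x Fx; first by exists X0 => //; case.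
have [X FX Xx] := IHn (x \o lift ord0) (fun i => Fx (lift ord0 i)).
have [Y FY Yx] := Fx ord0.
have [XY|YX] := totF X Y FX FY.
  by exists Y => // i; case: (unliftP ord0 i) => [j|] -> //; apply: XY (Xx j).
by exists X => // i; case: (unliftP ord0 i) => [j|] ->; [exact: Xx|exact: YX].
Qed.

Section TranscendenceBasis.

Variable K : fieldType.
Implicit Types A B : set K.

Lemma alg_independent_sub A B : A `<=` B -> alg_independent B -> alg_independent A.
Proof. by move=> AB indepB n x x_inj Ax; apply: indepB => // i; apply: AB. Qed.

Lemma transcendence_basis_extend A :
  alg_independent A -> exists2 B, A `<=` B & transcendence_basis B.
Proof.
move=> indepA.
(* Zorn's lemma is applied to the sets whose union with [A] is independent, so that the empty chain
   is covered by the independence of [A]. *)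
have [F FP totF|M [indepM maxM]] := @Zorn_bigcup K (fun B => alg_independent (A `|` B)).
  have [[X0 FX0]|F0] := pselect (F !=set0); last first.
    rewrite bigcup0 ?setU0 // => X FX; case: F0; exists X; exact: FX.
  move=> n x x_inj AFx.
  pose F' := [set A `|` X | X in F].
  (* Independence concerns finitely many elements at a time, and these all lie in one member of the
     chain. *)
  have [_ [X FX <-] AXx] : exists2 X, F' X & forall i, X (x i).
    apply: chain_bigcup_finite.
    - by exists (A `|` X0), X0.
    - move=> _ _ [X FX <-] [Y FY <-].
      by have [XY|YX] := totF X Y FX FY; [left|right]; apply: setUS.
    - move=> i; have [Ax|[X FX Xx]] := AFx i.
        by exists (A `|` X0); [exists X0|left].
      by exists (A `|` X); [exists X|right].
  exact: FP FX n x x_inj AXx.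
exists (A `|` M); first exact: subsetUl.
split=> // C indepC AMC; apply/seteqP; split=> // c Cc; right.
have -> : M = C.
  apply: contrapT => MC; apply: (maxM C).
    split=> [m Mm|CM]; first by apply: AMC; right.
    by apply: MC; apply/seteqP; split=> // m Mm; apply: AMC; right.
  by apply: alg_independent_sub indepC => a [Aa|//]; apply: AMC; left.
by [].
Qed.

End TranscendenceBasis.

(** * Sets with at most one element, and the equivalence of the three conditions *)

Lemma card_leI1P (T : Type) (B : set T) :
  B #<= `I_1 <-> forall x y, B x -> B y -> x = y.
Proof.
split=> [/pcard_leP[f] x y Bx By|eqB].
  apply: (@inj _ _ _ f); rewrite ?inE //.
  have := @funS _ _ _ _ f x Bx; have := @funS _ _ _ _ f y By.
  by rewrite /= !ltnS !leqn0 => /eqP -> /eqP ->.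
have [->|/set0P[b Bb]] := eqVneq B set0; first exact: card_ge0.
apply: (@card_le_trans _ _ _ [set b]).
  by apply: subset_card_le => x Bx; apply: eqB.
by have /card_eqPle[] := @card_set1 T b.
Qed.

Theorem theoremA (K : fieldType) (charK : [pchar K]%R =i pred0) :
  [<-> trdeg_gt K 1;
       exists d1 d2 : K -> K,
         [/\ is_derivation (idfun : {rmorphism K -> K}) d1,
             is_derivation (idfun : {rmorphism K -> K}) d2
           & incomparable_kernels d1 d2];
       exists (L : fieldType) (iota : {rmorphism K -> L}) (d1 d2 : K -> L),
         [/\ is_derivation iota d1, is_derivation iota d2
           & incomparable_kernels d1 d2]].
Proof.
have [f fE] := ratr_rmorphism_char0 charK.
have {fE} ratrE : @ratr K = f by apply/esym/funext.
split; last split.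
- move=> [B [[indepB _] /negP card_B]].
  have [x [y [Bx By xy]]] : exists x y, [/\ B x, B y & x <> y].
    apply: contrapT => eqB; apply: card_B; apply/card_leI1P => x y Bx By.
    by apply: contrapT => xy; apply: eqB; exists x, y.
  pose v := tnth [tuple x; y].
  have indep_v (p : {mpoly rat[2]}) : mmap f v p = 0 -> p = 0.
    rewrite -ratrE; apply: indepB => [|i].
      by apply/tuple_uniqP; rewrite /= inE andbT; apply/eqP.
    by have := mem_tnth i [tuple x; y]; rewrite !inE => /orP[] /eqP; rewrite /v => ->.
  have [d1 d1_der d1v] := exists_dual_derivation 0 charK indep_v.
  have [d2 d2_der d2v] := exists_dual_derivation 1 charK indep_v.
  (* [y] lies in the kernel of [d1] but not of [d2], and [x] the other way round. *)
  exists d1, d2; split=> //; split=> ker.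
    by have /eqP := ker (v 1) (d1v 1); rewrite d2v oner_eq0.
  by have /eqP := ker (v 0) (d2v 0); rewrite d1v oner_eq0.
- by move=> [d1 [d2 d12]]; exists K, idfun, d1, d2.
move=> [L [iota [d1 [d2 [d1_der d2_der [ker12 ker21]]]]]].
have [a [d1a d2a]] : exists a, d1 a = 0 /\ d2 a != 0.
  apply: contrapT => ker; apply: ker12 => a d1a; apply/eqP.
  by apply: contrapT => /negP d2a; apply: ker; exists a.
have [b [d2b d1b]] : exists b, d2 b = 0 /\ d1 b != 0.
  apply: contrapT => ker; apply: ker21 => b d2b; apply/eqP.
  by apply: contrapT => /negP d1b; apply: ker; exists b.
have indep_ab : alg_independent [set a; b].
  move=> n v v_inj v_ab p; rewrite ratrE.
  (* The derivation dual to [a] is [d2], the one dual to [b] is [d1]; injectivity of [v] ensures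
     that any other entry is the opposite element. *)
  apply: (dual_derivations_independent (iota := iota)) => i.
  have other j : j != i -> v j <> v i by move=> ji /v_inj; apply/eqP.
  case: (v_ab i) => vi; [exists d2|exists d1]; split; rewrite ?vi // => j /other.
    by case: (v_ab j) => ->; rewrite ?vi.
  by case: (v_ab j) => ->; rewrite ?vi.
have [B abB basisB] := transcendence_basis_extend indep_ab.
exists B; split=> //; apply/negP => /card_leI1P eqB.
have ab : a = b by apply: eqB; apply: abB; [left|right].
by move: d2a; rewrite ab d2b eqxx.
Qed.
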